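(* Let $G$ be a finite, simple, connected $3$-$\gamma_{c}$-critical graph, let $S$ be a minimum vertex cut set of $G$ and $I$ a maximum independent set of $G$. If $\kappa(G) + 1 \leq \alpha(G)$, $\kappa(G) < \delta(G)$ and $|S \setminus I| \leq 1$, then $G \in \mathcal{G}_{2}(3,3)$.
   Context: All graphs are finite, simple and connected. A set $D \subseteq V(G)$ is a connected dominating set of $G$ if every vertex of $G$ is in $D$ or adjacent to a vertex of $D$, and $G[D]$ is connected; $\gamma_{c}(G)$ is the minimum size of such a set. For non-adjacent $u,v$, $G+uv$ is $G$ with edge $uv$ added. $G$ is $3$-$\gamma_{c}$-critical if $\gamma_{c}(G)=3$ and $\gamma_{c}(G+uv)<3$ for every pair of non-adjacent vertices $u,v$. $\alpha(G)$ is the independence number, $\delta(G)$ the minimum degree, $\kappa(G)$ the connectivity; a vertex cut set is a set $S$ with $G-S$ disconnected, and a minimum one has size $\kappa(G)$. The class $\mathcal{G}_{2}(3,3)$: take integers $j_1, j_2 \geq 3$, pairwise disjoint vertex sets $J_1, J_2$ with $|J_1| = j_1$, $|J_2| = j_2$, two distinct vertices $u_1, u_2 \in J_2$, and three further vertices $w, w_1, v_1$. Form the graph on $J_1 \cup J_2 \cup \{w, w_1, v_1\}$ whose edges are exactly: all edges inside $J_1$, all edges inside $J_2$, $v_1$ joined to every vertex of $J_1$, $w_1$ joined to every vertex of $J_1 \cup (J_2 \setminus \{u_1\}) \cup \{w\}$, and $w$ joined to every vertex of $J_1 \cup (J_2 \setminus \{u_2\}) \cup \{w_1\}$. $\mathcal{G}_{2}(3,3)$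 is the class of all graphs (up to isomorphism) obtained this way. *)

(* Defs.v *)
From mathcomp Require Import all_boot.

Set Implicit Arguments.
Unset Strict Implicit.
Unset Printing Implicit Defensive.

Record sgraph := SGraph {
  vertex :> finType;
  adj : rel vertex;
  adj_sym : symmetric adj;
  adj_irr : irreflexive adj
}.

Section Graph.
Variable G : sgraph.
Implicit Types (S D I : {set G}) (u v x y : G).

Definition induced_adj D : rel G :=
  [rel x y | [&& x \in D, y \in D & adj x y]].

(* Connectedness of G[D]. The empty set counts as connected, so that S = V(G)
   is not a vertex cut below; nonemptiness of a connected dominating set of a
   nonempty graph follows from domination. *)
Definition connected_in D : bool :=
  [forall x in D, forall y in D, connect (induced_adj D) x y].

Definition connected_graph : bool := (0 < #|G|) && connected_in [set: G].

Definition dominating D : bool :=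
  [forall x, (x \in D) || [exists y in D, adj x y]].

Definition connected_dominating D : bool := dominating D && connected_in D.

(* The default #|G| is never the answer for a connected G unless V(G) itself
   is optimal; it is only a junk value for a disconnected G. *)
Definition gammac : nat :=
  \big[minn/#|G|]_(D : {set G} | connected_dominating D) #|D|.

Definition add_adj u v : rel G :=
  [rel x y | adj x y ||
     (x != y) && ((x == u) && (y == v) || (x == v) && (y == u))].

Lemma add_adj_sym u v : symmetric (add_adj u v).
Proof.
move=> x y; rewrite /add_adj /= adj_sym eq_sym; congr (_ || (_ && _)).
by rewrite orbC [(y == u) && _]andbC [(y == v) && _]andbC.
Qed.

Lemma add_adj_irr u v : irreflexive (add_adj u v).
Proof. by move=> x; rewrite /add_adj /= adj_irr eqxx. Qed.

Definition add_edge u v : sgraph := SGraph (add_adj_sym u v) (add_adj_irr u v).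

Definition independent I : bool :=
  [forall x in I, forall y in I, ~~ adj x y].

Definition alpha : nat := \max_(I : {set G} | independent I) #|I|.

Definition maximum_independent I : Prop := independent I /\ #|I| = alpha.

Definition degree x : nat := #|[set y | adj x y]|.

Definition delta : nat := \big[minn/#|G|]_(x : G) degree x.

Definition vertex_cut S : bool := ~~ connected_in (~: S).

Definition minimum_vertex_cut S : Prop :=
  vertex_cut S /\ (forall S', vertex_cut S' -> #|S| <= #|S'|).

(* Usual convention: kappa is the least number of vertices whose removal leaves
   a disconnected graph or at most one vertex, so kappa = #|G| - 1 on complete
   graphs; on other graphs it is the least size of a vertex cut. *)
Definition kappa : nat :=
  \big[minn/#|G|]_(S : {set G} | vertex_cut S || (#|~: S| <= 1)) #|S|.

End Graph.

Definition gammac_critical (k : nat) (G : sgraph) : Prop :=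
  gammac G = k /\
  (forall u v : G, u != v -> ~~ adj u v -> gammac (add_edge u v) < k).

(* Each edge of the construction, listed with one orientation. *)
Definition G2_join (G : sgraph) (J1 J2 : {set G}) (u1 u2 w w1 v1 : G) : rel G :=
  [rel x y |
    [|| [&& x \in J1, y \in J1 & x != y],
        [&& x \in J2, y \in J2 & x != y],
        (x == v1) && (y \in J1),
        (x == w1) && (y \in J1 :|: (J2 :\ u1) :|: [set w])
      | (x == w) && (y \in J1 :|: (J2 :\ u2) :|: [set w1])]].

(* Membership in G_2(3,3): G is, on its own vertex set, one of the graphs of
   the construction; this predicate is closed under isomorphism. *)
Definition in_G2_33 (G : sgraph) : Prop :=
  exists (J1 J2 : {set G}) (u1 u2 w w1 v1 : G),
    [/\ 3 <= #|J1| /\ 3 <= #|J2|,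
        [/\ u1 \in J2, u2 \in J2 & u1 != u2],
        [/\ uniq [:: w; w1; v1], [disjoint J1 & J2]
          & [disjoint J1 :|: J2 & [set w; w1; v1]]],
        J1 :|: J2 :|: [set w; w1; v1] = [set: G]
      & forall x y : G,
          adj x y = G2_join J1 J2 u1 u2 w w1 v1 x y
                    || G2_join J1 J2 u1 u2 w w1 v1 y x].

(* Main.v *)
Require Import Defs.
From mathcomp Require Import all_boot zify.

Set Implicit Arguments.
Unset Strict Implicit.
Unset Printing Implicit Defensive.

(** For non-adjacent x and y, criticality gives either a dominating pair {x, y}
    or a vertex z such that xz (or yz) is an edge dominating everything but y
    (or x).  If x lies outside the cut S, such a z must lie in S, since every
    component of G - S has at least two vertices by kappa < delta.  Applied to
    two vertices of I, this orients all pairs of I; comparing the orientation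
    with the components of G - S excludes S \subset I, and when S \ I = {w} it
    forces S = {w, h} and two components, whose cliques and attachments to S
    are then read off from suitable non-adjacent pairs. *)

(** * Minima over finite families *)

Lemma bigminn_le (T : finType) (P : pred T) (F : T -> nat) m j :
  P j -> \big[minn/m]_(i | P i) F i <= F j.
Proof.
move=> Pj; have := mem_index_enum j; elim: (index_enum T) => // a s IH.
rewrite inE big_cons => /orP [/eqP <-|js]; first by rewrite Pj geq_minl.
by case: ifP => _; rewrite ?geq_min IH ?orbT.
Qed.

Lemma bigminn_le_idx (T : finType) (P : pred T) (F : T -> nat) m :
  \big[minn/m]_(i | P i) F i <= m.
Proof. by elim/big_rec: _ => // i n _ le_nm; rewrite geq_min le_nm orbT. Qed.

Lemma bigminn_lt (T : finType) (P : pred T) (F : T -> nat) m k :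
  \big[minn/m]_(i | P i) F i < k -> m < k \/ exists2 i, P i & F i < k.
Proof.
elim/big_rec: _ => [|i n Pi IH]; first by left.
by rewrite gtn_min => /orP [ltk|/IH //]; right; exists i.
Qed.

Lemma bigminn_ge (T : finType) (P : pred T) (F : T -> nat) m k :
  k <= m -> (forall i, P i -> k <= F i) -> k <= \big[minn/m]_(i | P i) F i.
Proof.
by move=> le_km leF; elim/big_rec: _ => // i n Pi le_kn; rewrite leq_min leF.
Qed.

(** * Pairs of dominating vertices in a critical graph *)

Section Domination.
Variable G : sgraph.
Implicit Types (S D I : {set G}) (u v x y z : G).

Definition dom x v := (x == v) || adj x v.

Definition dom2 x y := forall v, dom x v || dom y v.

(** What remains in [G] when the pair [x], [z] dominates [G + xy] only thanks to the new edge;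
    called below an arrow from [x] to [y] through [z]. *)
Definition dom_but x z y :=
  [/\ adj x z, z != y, ~~ adj z y & forall v, v != y -> dom x v || dom z v].

Lemma adj_neq x y : adj x y -> x != y.
Proof. by apply: contraTneq => ->; rewrite adj_irr. Qed.

Lemma dom2C x y : dom2 x y -> dom2 y x.
Proof. by move=> d v; rewrite orbC. Qed.

Lemma dom_but_dom x z y v : dom_but x z y -> v != y -> ~~ dom x v -> dom z v.
Proof. by case=> _ _ _ d vy /negPf nx; have := d v vy; rewrite nx. Qed.

Lemma delta_le_degree x : delta G <= degree x.
Proof. exact: bigminn_le. Qed.

(** [kappa] also ranges over sets leaving at most one vertex; a cut leaves at least one, so it is no
    larger than any of those. *)
Lemma leq_kappa_cut S : minimum_vertex_cut S -> #|S| <= kappa G.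
Proof.
case=> cutS minS; apply: bigminn_ge => [|T /orP [/minS //|T1]].
  exact: max_card.
have : 0 < #|~: S|.
  rewrite card_gt0; apply: contraNneq cutS => ->.
  by apply/forall_inP => x; rewrite inE.
have := cardsC S; have := cardsC T; lia.
Qed.

Hypothesis Gcrit : gammac_critical 3 G.
Let gammacG : gammac G = 3 := Gcrit.1.

(** Otherwise [{x, y}] would be a connected dominating set of size at most 2. *)
Lemma adj_not_dom2 x y : adj x y -> ~ dom2 x y.
Proof.
move=> xy dxy; have : #|[set x; y]| <= 2 by rewrite cards2; case: (x != y).
apply/negP; rewrite -ltnNge -gammacG; apply: bigminn_le; apply/andP; split.
  apply/forallP => v; have := dxy v; rewrite /dom !inE => /orP [] /orP [/eqP->|av].
  - by rewrite eqxx.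
  - by apply/orP; right; apply/exists_inP; exists x; rewrite ?inE ?eqxx // adj_sym.
  - by rewrite eqxx orbT.
  - by apply/orP; right; apply/exists_inP; exists y; rewrite ?inE ?eqxx ?orbT // adj_sym.
apply/forall_inP => a; rewrite !inE => Ha; apply/forall_inP => b; rewrite !inE => Hb.
have [-> //|ab] := eqVneq a b; apply: connect1.
rewrite /induced_adj /= !inE Ha Hb /=.
case/orP: Ha ab => /eqP->; case/orP: Hb => /eqP->; rewrite ?eqxx //.
by rewrite adj_sym.
Qed.

Hypothesis Gdelta : 0 < delta G.

Lemma has_neighbour x : exists y, adj x y.
Proof.
have : 0 < degree x := leq_trans Gdelta (delta_le_degree x).
by rewrite card_gt0 => /set0Pn [y]; rewrite inE; exists y.
Qed.

Lemma add_edge_dom2 x y : x != y -> ~~ adj x y ->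
  exists a b, add_adj x y a b /\
    forall v, [|| a == v, b == v, add_adj x y a v | add_adj x y b v].
Proof.
move=> xy nxy; case: (bigminn_lt (Gcrit.2 x y xy nxy)) => [lt3|[D /andP [domD conD] ltD]].
  (* The default value [#|G|] of the minimum is at least [gammac G = 3], so the small value comes
     from a set [D]. *)
  have : gammac G <= #|G| by apply: bigminn_le_idx.
  by rewrite gammacG leqNgt lt3.
have dD v : exists2 a, a \in D & (a == v) || add_adj x y a v.
  have /orP [vD|/exists_inP [a aD va]] := forallP domD v.
    by exists v; rewrite ?eqxx.
  by exists a => //; rewrite (add_adj_sym x y a v) (va : add_adj x y v a) orbT.
have [a aD _] := dD x.
(* A one-vertex [D] is padded with an arbitrary neighbour of its vertex. *)
have [/eqP D1|/set0Pn [b]] := boolP (D :\ a == set0).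
  have {}dD v : (a == v) || add_adj x y a v.
    have [b bD bv] := dD v; have : b \notin D :\ a by rewrite D1 inE.
    by rewrite !inE bD andbT negbK => /eqP <-.
  have [b ab] := has_neighbour a; exists a, b; split=> [|v].
    by rewrite /add_adj /= ab.
  by have /orP [->|->] := dD v; rewrite ?orbT.
rewrite !inE => /andP [ba bD].
have Dab c : c \in D -> c = a \/ c = b.
  move=> cD; have [|ca] := eqVneq c a; [by left|right].
  apply: contraTeq ltD => cb; rewrite -leqNgt.
  have /subset_leq_card : [set a; b; c] \subset D.
    by apply/subsetP => d; rewrite !inE => /orP [/orP[]|] /eqP->.
  rewrite -setUA cardsU1 cards2 !inE (eq_sym a b) (negPf ba) (eq_sym a c).
  by rewrite (negPf ca) (eq_sym b c) cb.
(* The first step of a path inside [D] from [a] to [b] can only lead to [b]. *)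
exists a, b; split=> [|v].
  have /forall_inP/(_ b bD) := forall_inP conD a aD.
  case/connectP => [[|c p]] /= => [_ e|/andP [/and3P [_ cD ac] _] _].
    by rewrite e eqxx in ba.
  case: (Dab c cD) => e; rewrite e in ac => //.
  by have := add_adj_irr x y a; rewrite (ac : add_adj x y a a).
by have [c /Dab [->|->] /orP [->|->]] := dD v; rewrite ?orbT.
Qed.

(** Only the new edge takes [a] to [v], so these are its two ends; every other vertex is already
    dominated in [G]. *)
Lemma add_edge_dom_but x y a b v : adj a b ->
  (forall v, [|| a == v, b == v, add_adj x y a v | add_adj x y b v]) ->
  ~~ dom a v -> ~~ dom b v -> add_adj x y a v ->
  dom_but x b y \/ dom_but y b x.
Proof.
move=> ab dab; rewrite /dom !negb_or => /andP [av nav] /andP [bv nbv].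
rewrite {1}/add_adj /= (negPf nav) av /= => H.
have {}dab u : u != v -> dom a u || dom b u.
  move=> uv; have := dab u; rewrite /dom /add_adj /=.
  case/orP: H => /andP [/eqP ea /eqP ev]; subst;
    case/or4P => [->|->|/orP [->|]|/orP [->|]]; rewrite ?orbT //;
    rewrite ?eqxx ?(negPf uv) ?(negPf av) ?(negPf bv) ?andbF ?andbT ?orbF //=;
    by case/and3P => _ _ /eqP->; rewrite eqxx.
by case/orP: H => /andP [/eqP ea /eqP ev]; subst; [left|right]; split.
Qed.

(** If the pair dominating [G + xy] is an edge of [G], it misses some vertex of [G], reached only by
    the new edge: an arrow. Otherwise the pair is [{x, y}] itself, and the new edge adds nothing to
    what it dominates. *)
Lemma nonadj_cases x y : x != y -> ~~ adj x y ->
  [\/ dom2 x y, exists z, dom_but x z y | exists z, dom_but y z x].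
Proof.
move=> xy nxy; have [a [b [ab dab]]] := add_edge_dom2 xy nxy.
have [gab|nab] := boolP (adj a b).
  have [/forallP/(adj_not_dom2 gab) //|] := boolP [forall v, dom a v || dom b v].
  rewrite negb_forall => /existsP [v]; rewrite negb_or => /andP [na nb].
  have nab : (a != v) && (b != v).
    by move: na nb; rewrite /dom !negb_or => /andP [-> _] /andP [->].
  have := dab v; case/andP: nab => /negPf-> /negPf-> /= /orP [av|bv].
    by case: (add_edge_dom_but gab dab na nb av) => H; [apply: Or32|apply: Or33]; exists b.
  have dba u : [|| b == u, a == u, add_adj x y b u | add_adj x y a u].
    by case/or4P: (dab u) => ->; rewrite ?orbT.
  rewrite adj_sym in gab.
  by case: (add_edge_dom_but gab dba nb na bv) => H; [apply: Or32|apply: Or33]; exists a.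
apply: Or31; move: ab; rewrite {1}/add_adj /= (negPf nab) /= => /andP [_ H].
have {}dab v : dom a v || dom b v.
  have := dab v; rewrite /dom /add_adj /=.
  case/or4P => [->|->|/orP [->|]|/orP [->|]]; rewrite ?orbT //;
    by case/orP: H => /andP [/eqP-> /eqP->] /andP [_] /orP [] /andP [_ /eqP->];
    rewrite ?eqxx ?orbT.
by case/orP: H => /andP [/eqP ea /eqP eb]; subst=> //; apply: dom2C.
Qed.

End Domination.

(** * Components of [G - S] for a cut smaller than the minimum degree *)

Section Cut.
Variables (G : sgraph) (S : {set G}).
Implicit Types u v x y z : G.
Hypotheses (Gconn : connected_graph G) (Gcrit : gammac_critical 3 G).
Hypotheses (Scut : vertex_cut S) (Sdeg : #|S| < delta G).

(** A canonical representative, so that equal values mean the same component of [G - S]; vertices of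
    [S] are isolated for this relation. *)
Definition comp x := root (induced_adj (~: S)) x.

Let Gdelta : 0 < delta G.
Proof. exact: leq_ltn_trans Sdeg. Qed.

Lemma induced_connect_sym : connect_sym (induced_adj (~: S)).
Proof.
by apply: sym_connect_sym => x y; rewrite /induced_adj /= adj_sym andbCA.
Qed.

Lemma comp_adj x y : x \notin S -> y \notin S -> adj x y -> comp x = comp y.
Proof.
move=> xS yS xy.
apply/(rootP induced_connect_sym)/connect1.
by rewrite /induced_adj /= !inE xS yS.
Qed.

Lemma comp_dom x y : x \notin S -> y \notin S -> dom x y -> comp x = comp y.
Proof. by move=> xS yS /orP [/eqP->|] //; apply: comp_adj. Qed.

Lemma comp_not_dom x y :
  x \notin S -> y \notin S -> comp x != comp y -> ~~ dom x y.
Proof. by move=> xS yS; apply: contraNN => d; rewrite (comp_dom xS yS d). Qed.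

Lemma comp_other x : exists2 y, y \notin S & comp x != comp y.
Proof.
have [/exists_inP [y yS xy]|no] := boolP [exists y in ~: S, comp x != comp y].
  by exists y; rewrite // -in_setC.
case/negP: Scut; apply/forall_inP => a aS; apply/forall_inP => b bS.
apply/(rootP induced_connect_sym); rewrite negb_exists_in in no.
move/forall_inP: no => no.
by move: (no a aS) (no b bS); rewrite !negbK /comp => /eqP <- /eqP <-.
Qed.

(** The neighbours of [x] outnumber [S]; hence no component is a single vertex. *)
Lemma comp_neighbour x : x \notin S ->
  exists y, [/\ y \notin S, adj x y & comp y = comp x].
Proof.
move=> xS; have : ~~ ([set y | adj x y] \subset S).
  apply: contraTN (leq_trans Sdeg (delta_le_degree x)) => /subset_leq_card.
  by rewrite -leqNgt.
case/subsetPn => y; rewrite inE => xy yS; exists y; split=> //.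
by rewrite (comp_adj xS yS).
Qed.

(** With [z] outside [S], the edge [xz] would stay in one component and [y] would be the only vertex
    of all the others, which have at least two. *)
Lemma dom_but_in_cut x z y : x \notin S -> dom_but x z y -> z \in S.
Proof.
move=> xS H; have [xz _ _ _] := H.
apply/negPn/negP => zS; have cz := comp_adj xS zS xz.
have far v : v \notin S -> comp x != comp v -> v = y.
  move=> vS xv; apply/eqP/negPn/negP => vy.
  have := dom_but_dom H vy (comp_not_dom xS vS xv).
  by apply/negP/(comp_not_dom zS vS); rewrite -cz.
have [v vS xv] := comp_other x; have [t [tS vt ct]] := comp_neighbour vS.
have xt : comp x != comp t by rewrite ct.
by have := adj_neq vt; rewrite (far v vS xv) (far t tS xt) eqxx.
Qed.

Lemma dom_but_far x z y v : x \notin S -> dom_but x z y ->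
  v \notin S -> comp x != comp v -> v != y -> adj z v.
Proof.
move=> xS H vS xv vy; have zS := dom_but_in_cut xS H.
have /orP [/eqP e|//] := dom_but_dom H vy (comp_not_dom xS vS xv).
by rewrite -e zS in vS.
Qed.

Lemma dom_but_far_cut x z y v : x \in S -> z \notin S -> dom_but x z y ->
  v \notin S -> comp z != comp v -> v != y -> adj x v.
Proof.
move=> xS zS [_ _ _ d] vS zv vy; have := d v vy.
rewrite (negPf (comp_not_dom zS vS zv)) orbF => /orP [/eqP e|//].
by rewrite -e xS in vS.
Qed.

(** * Exclusion of one-vertex cuts *)

Lemma comp_exit x s : x \notin S -> S = [set s] ->
  exists v, [/\ v \notin S, comp v = comp x & adj s v].
Proof.
move=> xS eS; pose A := [pred v | (v \notin S) && (comp v == comp x)].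
have [/existsP [v /andP [/andP [vS /eqP cv] sv]]|no] := boolP [exists v, A v && adj s v].
  by exists v.
(* Without a neighbour of [s], the component would be closed under adjacency in the whole connected
   graph. *)
have clA : closed (induced_adj [set: G]) A.
  apply: intro_closed => [|a b /and3P [_ _ ab] /andP [aS /eqP ca]].
    by apply: sym_connect_sym => a b; rewrite /induced_adj /= !inE adj_sym.
  have bS : b \notin S.
    apply: contraNN no; rewrite eS inE => /eqP e; apply/existsP; exists a.
    by rewrite /= aS ca eqxx adj_sym -e.
  by rewrite inE bS -(comp_adj aS bS ab) ca /=.
have /andP [_ /forall_inP/(_ x (in_setT _))/forall_inP/(_ s (in_setT _))] := Gconn.
move/(closed_connect clA); rewrite !inE xS eqxx eS inE eqxx /=.
by [].
Qed.

(** For [S = {s}], every case yields a neighbour [t] of [s] such that [s] and [t] dominate [G]. *)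
Lemma cut_neq1 : #|S| != 1.
Proof.
apply/negP => /cards1P [s eS].
have sS : s \in S by rewrite eS inE.
have S1 v : v \in S -> v = s by rewrite eS inE => /eqP.
have NS v : v != s -> v \notin S by rewrite eS inE.
have key x y : x != s -> ~~ adj x s -> y \notin S -> comp x != comp y ->
    adj s y /\ ((forall v, v \notin S -> comp x = comp v -> dom x v) \/
                (forall v, v \notin S -> comp x = comp v -> v != x -> adj s v)).
  move=> xs nxs yS xy; have xS := NS x xs.
  have := comp_not_dom xS yS xy; rewrite /dom negb_or => /andP [nxy naxy].
  case: (nonadj_cases Gcrit Gdelta nxy naxy) => [d|[z H]|[z H]].
  - split.
      have := d s; rewrite /dom (negPf xs) (negPf nxs) adj_sym /=.
      by case/orP=> [/eqP e|//]; rewrite e sS in yS.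
    left=> v vS xv; have := d v.
    by rewrite (negPf (comp_not_dom yS vS _)) ?orbF // -xv eq_sym.
  - have [xz _ _ _] := H; case/negP: nxs.
    by rewrite -(S1 z) // (dom_but_in_cut xS H).
  - have e := S1 z (dom_but_in_cut yS H); have [yz _ _ _] := H.
    split; first by rewrite -e adj_sym.
    right=> v vS xv vx; rewrite -e (dom_but_far yS H) //.
    by rewrite -xv eq_sym.
(* The second alternative of [key] is impossible: [s] would dominate everything but [x], and a
   neighbour [t] of [x] in its component would dominate [x]. *)
have far x : x != s -> ~~ adj x s ->
    (forall v, v \notin S -> comp x != comp v -> adj s v) /\
    (forall v, v \notin S -> comp x = comp v -> dom x v).
  move=> xs nxs; have [y yS xy] := comp_other x.
  have f v : v \notin S -> comp x != comp v -> adj s v.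
    by move=> vS xv; case: (key x v xs nxs vS xv).
  split=> //; have [_ [//|K]] := key x y xs nxs yS xy.
  have [t [tS xt ct]] := comp_neighbour (NS x xs).
  have st : adj s t by apply: K; rewrite // eq_sym adj_neq.
  case: (adj_not_dom2 Gcrit st) => v; rewrite /dom.
  have [//|vs] := eqVneq s v; have vS : v \notin S by rewrite NS // eq_sym.
  have [xv|/(f v vS)->//] := eqVneq (comp x) (comp v).
  have [->|vx] := eqVneq v x; first by rewrite [adj t x]adj_sym xt !orbT.
  by rewrite (K v vS xv vx).
have [/existsP [x /andP [xs nxs]]|all] := boolP [exists x, (x != s) && ~~ adj x s].
  have xS := NS x xs; have [fx dx] := far x xs nxs.
  have [t [tS ct st]] := comp_exit xS eS.
  (* A vertex [v] missed by [s] lies in the component of [x]; [far] applied to [v] makes it adjacent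
     to [t]. *)
  case: (adj_not_dom2 Gcrit st) => v; rewrite /dom.
  have [//|vs] := eqVneq s v; have [//|nsv] := boolP (adj s v).
  rewrite eq_sym in vs; rewrite adj_sym in nsv; have vS := NS v vs.
  have [xv|/(fx v vS)] := eqVneq (comp x) (comp v); last by rewrite adj_sym (negPf nsv).
  have [_ /(_ t tS)] := far v vs nsv.
  by rewrite ct xv eq_sym adj_sym; apply.
have [t st] := has_neighbour Gdelta s; case: (adj_not_dom2 Gcrit st) => v.
rewrite negb_exists in all; have := forallP all v.
by rewrite /dom eq_sym negb_and !negbK adj_sym => ->.
Qed.

Lemma cut_gt1 : 1 < #|S|.
Proof.
rewrite ltn_neqAle eq_sym cut_neq1 card_gt0; apply: contraTneq Gconn => S0.
by apply: contraNN Scut; rewrite S0 setC0 => /andP [].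
Qed.

(** * Arrows between vertices of an independent set larger than [S] *)

Variable I : {set G}.
Hypotheses (Iind : independent I) (SI : #|S| < #|I|).

Lemma independent_nadj x y : x \in I -> y \in I -> ~~ adj x y.
Proof. by move=> xI; apply: (forall_inP (forall_inP Iind x xI)). Qed.

Lemma dom_but_notin x z y : x \in I -> dom_but x z y -> z \notin I.
Proof.
move=> xI [xz _ _ _]; apply: contraTN xz => zI.
exact: independent_nadj.
Qed.

(** By independence [x] dominates no other vertex of [I], which leaves them to [z]. *)
Lemma dom_but_independent x z y v :
  x \in I -> dom_but x z y -> v \in I -> v != y -> adj z v.
Proof.
move=> xI H vI vy; have zI := dom_but_notin xI H.
have [->|vx] := eqVneq v x; first by rewrite adj_sym; case: H.
have /orP [/eqP e|//] : dom z v; last by rewrite -e (negPf zI) in vI.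
apply: (dom_but_dom H vy).
by rewrite /dom eq_sym (negPf vx) independent_nadj.
Qed.

(** Since [I] has at least three vertices, [x] and [y] leave a third one undominated, so they are
    not a dominating pair. *)
Lemma independent_arrow x y : x \in I -> y \in I -> x != y ->
  (exists z, dom_but x z y) \/ (exists z, dom_but y z x).
Proof.
move=> xI yI xy.
case: (nonadj_cases Gcrit Gdelta xy (independent_nadj xI yI)); [|by left|by right].
move=> d; have : ~~ (I \subset [set x; y]).
  apply/negP => /subset_leq_card; rewrite cards2 xy leqNgt.
  by rewrite (leq_ltn_trans cut_gt1 SI).
case/subsetPn => v vI; rewrite !inE negb_or => /andP [vx vy].
have := d v; rewrite /dom ![_ == v]eq_sym (negPf vx) (negPf vy).
by rewrite (negPf (independent_nadj xI vI)) (negPf (independent_nadj yI vI)).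
Qed.

(** If [S] lies in [I], no arrow from [I] passes through [S], so none leaves [r]. This determines
    how [S] meets the component of [r] and forbids arrows between two vertices of [S]. *)
Lemma cut_not_sub_independent : ~~ (S \subset I).
Proof.
apply/negP => /subsetP sub.
have /subsetPn [r rI rS] : ~~ (I \subset S).
  by apply: contraTN SI => /subset_leq_card; rewrite leqNgt.
have Sr s : s \in S -> ~~ adj s r by move=> /sub sI; apply: independent_nadj.
have src x z y : x \in I -> dom_but x z y -> z \notin S.
  by move=> xI H; apply: contraNN (dom_but_notin xI H); apply: sub.
have [y yS ry] := comp_other r.
(* [r] dominates its component: an arrow from [y] to [r] would make all of [S] adjacent to [y], and
   then the pair [v], [y] can only be resolved with [v] adjacent to [r]. *)
have domr v : v \notin S -> comp v = comp r -> dom r v.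
  move=> vS cv.
  have yv : comp y != comp v by rewrite cv eq_sym.
  have /norP [nry ary] : ~~ dom r y by apply: comp_not_dom.
  case: (nonadj_cases Gcrit Gdelta nry ary) => [d|[z H]|[z H]].
  - by have := d v; rewrite (negPf (comp_not_dom yS vS yv)) orbF.
  - by have := dom_but_in_cut rS H; rewrite (negPf (src _ _ _ rI H)).
  have zS := dom_but_in_cut yS H.
  have Sy s : s \in S -> adj s y.
    move=> sS; have [->|sz] := eqVneq s z; first by rewrite adj_sym; case: H.
    have sr : s != r by apply: contraTneq sS => ->.
    case: H => _ _ _ /(_ s sr); rewrite /dom (eq_sym z s) (negPf sz) /=.
    rewrite (negPf (independent_nadj (sub _ zS) (sub _ sS))) orbF adj_sym.
    by case/orP=> [/eqP e|//]; rewrite e sS in yS.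
  have [->|vr] := eqVneq v r; first by rewrite /dom eqxx.
  have /norP [nvy avy] : ~~ dom v y by apply: comp_not_dom; rewrite // eq_sym.
  have dyr : dom y r = false by apply: negbTE; apply: comp_not_dom; rewrite // eq_sym.
  have rv : r != v by rewrite eq_sym.
  case: (nonadj_cases Gcrit Gdelta nvy avy) => [d|[t K]|[t K]].
  - by have := d r; rewrite dyr orbF /dom eq_sym adj_sym.
  - have tS := dom_but_in_cut vS K; case: K => _ _.
    by rewrite Sy.
  - have tS := dom_but_in_cut yS K; have := dom_but_dom K rv; rewrite dyr.
    case/(_ isT)/orP => [/eqP e|]; last by rewrite (negPf (Sr t tS)).
    by rewrite -e tS in rS.
(* The arrow between [s] and [r] leaves [s]; its middle vertex misses [r], so by [domr] it lies in
   another component and [s] has to dominate this one. *)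
have Sdom s v : s \in S -> v \notin S -> comp v = comp r -> v != r -> adj s v.
  move=> sS vS cv vr; have sr : s != r by apply: contraTneq sS => ->.
  case: (independent_arrow (sub s sS) rI sr) => [] [z H]; last first.
    by have := dom_but_in_cut rS H; rewrite (negPf (src _ _ _ rI H)).
  have zS := src _ _ _ (sub s sS) H.
  apply: (dom_but_far_cut sS zS H) => //; apply/negP => /eqP zv.
  have [_ zr nzr _] := H; have := domr z zS (etrans zv cv).
  by rewrite /dom eq_sym (negPf zr) adj_sym (negPf nzr).
(* The middle vertex [z] is adjacent to [r], so [Sdom] makes it adjacent to [s']. *)
have no s s' z : s \in S -> s' \in S -> ~ dom_but s z s'.
  move=> sS s'S H; have zS := src _ _ _ (sub s sS) H.
  have rs' : r != s' by apply: contraTneq s'S => <-.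
  have zr := dom_but_independent (sub s sS) H rI rs'.
  have := Sdom s' z s'S zS (comp_adj zS rS zr) (adj_neq zr).
  by case: H => _ _; rewrite adj_sym => /negPf->.
case/card_gt1P: cut_gt1 => s [s' [sS s'S ss']].
case: (independent_arrow (sub s sS) (sub s' s'S) ss') => [] [z H].
  exact: (no s s' z).
exact: (no s' s z).
Qed.

(** * Structure of [G] when only [w] may lie in [S] outside [I] *)

Section Structure.
Variables w h r r' : G.
Hypotheses (wS : w \in S) (SwI : forall s, s \in S -> s != w -> s \in I).
Hypotheses (hS : h \in S) (hw : h != w).
Hypotheses (rI : r \in I) (rS : r \notin S) (r'I : r' \in I) (r'S : r' \notin S).
Hypotheses (rr' : r != r') (Hw : dom_but r w r').

Let SN v s : v \notin S -> s \in S -> v != s.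
Proof. by move=> vS sS; apply: contraNneq vS => ->. Qed.

Lemma w_nadj_r' : ~~ adj w r'. Proof. by case: Hw. Qed.

Lemma w_adj_r : adj w r. Proof. by rewrite adj_sym; case: Hw. Qed.

Lemma cut_nadj_r' s : s \in S -> ~~ adj s r'.
Proof.
move=> sS; have [->|sw] := eqVneq s w; first exact: w_nadj_r'.
exact: independent_nadj (SwI sS sw) r'I.
Qed.

Lemma cut_ndom_r' s : s \in S -> ~~ dom s r'.
Proof. by move=> sS; rewrite /dom negb_or cut_nadj_r' // eq_sym SN. Qed.

Lemma cut_nadj_r s : s \in S -> s != w -> ~~ adj s r.
Proof. by move=> sS sw; apply: independent_nadj (SwI sS sw) rI. Qed.

Lemma r_ndom_r' : ~~ dom r r'.
Proof. by rewrite /dom negb_or rr' independent_nadj. Qed.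

Lemma w_adj_h : adj w h.
Proof. by rewrite (dom_but_independent rI Hw) ?SwI // eq_sym SN. Qed.

(** An arrow from [r] to [s] would pass through a vertex of [S] adjacent to [r']. So the arrow goes
    from [s] to [r], through the component of [r'], and [s] dominates the rest. *)
Lemma cut_adj_far_r' s v : s \in S -> s != w ->
  v \notin S -> comp r' != comp v -> v != r -> adj s v.
Proof.
move=> sS sw vS cv vr; have sI := SwI sS sw.
have rs := SN rS sS; have r's := SN r'S sS; have r'r : r' != r by rewrite eq_sym.
case: (independent_arrow rI sI rs) => [] [z H].
  have zS := dom_but_in_cut rS H.
  have zr' := dom_but_independent rI H r'I r's.
  by case/negP: (cut_nadj_r' zS).
have zr' := dom_but_independent sI H r'I r'r.
have zS : z \notin S by apply: contraTN zr'; apply: cut_nadj_r'.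
by apply: (dom_but_far_cut sS zS H); rewrite // (comp_adj zS r'S zr').
Qed.

Lemma w_adj_far_r v : v \notin S -> comp r != comp v -> v != r' -> adj w v.
Proof. exact: dom_but_far. Qed.

(** A vertex [v] in a third component is adjacent to all of [S], so no arrow goes from [r] to [v];
    in the other two cases [r'] stays undominated. *)
Lemma two_comps v : v \notin S -> comp r != comp v -> comp r' = comp v.
Proof.
move=> vS rv; apply/eqP/negPn/negP => r'v.
have Sv s : s \in S -> adj s v.
  move=> sS; have [->|sw] := eqVneq s w.
    by apply: w_adj_far_r => //; apply: contraNneq r'v => ->.
  by apply: cut_adj_far_r' => //; apply: contraNneq rv => ->.
have /norP [nrv arv] : ~~ dom r v by apply: comp_not_dom.
have nvr' : ~~ dom v r' by apply: comp_not_dom; rewrite // eq_sym.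
have r'r : r' != r by rewrite eq_sym.
case: (nonadj_cases Gcrit Gdelta nrv arv) => [d|[z H]|[z H]].
- by have := d r'; rewrite (negPf r_ndom_r') (negPf nvr').
- by have zS := dom_but_in_cut rS H; case: H => _ _; rewrite Sv.
- have zS := dom_but_in_cut vS H.
  by case/negP: (cut_ndom_r' zS); apply: (dom_but_dom H).
Qed.

Lemma comp_rr' : comp r != comp r'.
Proof. by have [y yS ry] := comp_other r; rewrite (two_comps yS ry). Qed.

Lemma comp_cases v : v \notin S -> comp v = comp r \/ comp v = comp r'.
Proof.
move=> vS; have [->|/(two_comps vS)->] := eqVneq (comp r) (comp v).
  by left.
by right.
Qed.

(** An arrow between two vertices of [S] other than [w] would pass through a vertex outside [S]
    adjacent to both [r] and [r'], joining their components. *)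
Lemma cut_pair s : s \in S -> s = w \/ s = h.
Proof.
move=> sS; have [|sw] := eqVneq s w; [by left|right].
have [//|sh] := eqVneq s h.
have no a b z : a \in S -> a != w -> b \in S -> ~ dom_but a z b.
  move=> aS aw bS H; have aI := SwI aS aw.
  have zr := dom_but_independent aI H rI (SN rS bS).
  have zr' := dom_but_independent aI H r'I (SN r'S bS).
  have zS : z \notin S by apply: contraTN zr'; apply: cut_nadj_r'.
  by case/eqP: comp_rr'; rewrite -(comp_adj zS rS zr) -(comp_adj zS r'S zr').
case: (independent_arrow (SwI sS sw) (SwI hS hw) sh) => [] [z H].
  by case: (no s h z).
by case: (no h s z).
Qed.

(** Compare [c] with [r]: neither [r] nor any vertex of [S] dominates [r'], so [c] does. An arrow
    from [c] to [r] avoids [w], a neighbour of [r], and thus passes through [h]. *)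
Lemma side1_adj c : c \notin S -> comp c = comp r' -> c != r' ->
  adj c h /\ adj c r'.
Proof.
move=> cS cc cr'.
have r'c : r' != c by rewrite eq_sym.
have /norP [ncr acr] : ~~ dom c r by apply: comp_not_dom; rewrite // cc eq_sym comp_rr'.
case: (nonadj_cases Gcrit Gdelta ncr acr) => [d|[z H]|[z H]].
- split.
    have := d h; rewrite /dom (negPf (SN cS hS)) (negPf (SN rS hS)) /=.
    by rewrite [adj r h]adj_sym (negPf (cut_nadj_r hS hw)) orbF.
  by have := d r'; rewrite (negPf r_ndom_r') orbF /dom (negPf cr').
- have zS := dom_but_in_cut cS H; have [cz _ nzr _] := H.
  have e : z = h by case: (cut_pair zS) nzr => // ->; rewrite w_adj_r.
  split; first by rewrite -e.
  have r'r : r' != r by rewrite eq_sym.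
  case: H => _ _ _ /(_ r' r'r).
  by rewrite (negPf (cut_ndom_r' zS)) orbF /dom (negPf cr').
- have zS := dom_but_in_cut rS H.
  by case/negP: (cut_ndom_r' zS); apply: (dom_but_dom H r'c r_ndom_r').
Qed.

(** Otherwise [w] and a neighbour [c] of [r'] outside [S] would be an adjacent dominating pair. *)
Lemma w_missed : exists u, [/\ u \notin S, comp u = comp r & ~~ adj w u].
Proof.
have [c [cS r'c cc]] := comp_neighbour r'S.
have cr' : c != r' by rewrite eq_sym adj_neq.
have wc : adj w c by apply: w_adj_far_r; rewrite // cc comp_rr'.
have [/existsP [u /and3P [uS /eqP cu nwu]]|no] :=
  boolP [exists u, [&& u \notin S, comp u == comp r & ~~ adj w u]]; first by exists u.
case: (adj_not_dom2 Gcrit wc) => v; have [vS|vS] := boolP (v \in S).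
  by case: (cut_pair vS) => ->; rewrite /dom ?eqxx // w_adj_h orbT.
have [cv|cv] := comp_cases vS.
  rewrite /dom; have : ~~ [&& v \notin S, comp v == comp r & ~~ adj w v].
    by apply: contraNN no => H; apply/existsP; exists v.
  by rewrite vS cv eqxx negbK /= => ->; rewrite orbT.
have [->|vr'] := eqVneq v r'; first by rewrite /dom [adj c r']adj_sym r'c !orbT.
by rewrite /dom w_adj_far_r ?orbT // cv comp_rr'.
Qed.

Lemma side2_ndom_r' x : x \notin S -> comp x = comp r -> ~~ dom x r'.
Proof. by move=> xS cx; apply: comp_not_dom; rewrite // cx comp_rr'. Qed.

(** The middle vertex would lie in [S] and have to dominate [r']. *)
Lemma side2_no_dom_but x z y : x \notin S -> comp x = comp r -> y != r' ->
  ~ dom_but x z y.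
Proof.
move=> xS cx yr' H; case/negP: (cut_ndom_r' (dom_but_in_cut xS H)).
by apply: (dom_but_dom H); rewrite ?side2_ndom_r' // eq_sym.
Qed.

Lemma side2_neq_r' x : comp x = comp r -> x != r'.
Proof. by move=> cx; apply: contraNneq comp_rr' => <-; rewrite cx. Qed.

(** The only possibility for the pair [u], [w] is an arrow from [w] to [u]; its middle vertex
    dominates [r'], so it lies in that component and leaves [v] to [w]. *)
Lemma w_missed_uniq u v : u \notin S -> comp u = comp r -> ~~ adj w u ->
  v \notin S -> comp v = comp r -> v != u -> adj w v.
Proof.
move=> uS cu nwu vS cv vu; have wr' : w != r' by rewrite eq_sym SN.
rewrite adj_sym in nwu.
case: (nonadj_cases Gcrit Gdelta (SN uS wS) nwu) => [d|[z H]|[z H]].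
- by have := d r'; rewrite (negPf (side2_ndom_r' uS cu)) (negPf (cut_ndom_r' wS)).
- by case: (side2_no_dom_but uS cu wr' H).
have r'u : r' != u by rewrite eq_sym side2_neq_r'.
have zr' : dom z r' := dom_but_dom H r'u (cut_ndom_r' wS).
have zS : z \notin S by apply: contraTN zr'; apply: cut_ndom_r'.
have cz := comp_dom zS r'S zr'; have [_ _ _ /(_ v vu)] := H.
rewrite (negPf (comp_not_dom zS vS _)) ?cz ?cv 1?eq_sym ?comp_rr' // orbF.
by rewrite /dom eq_sym (negPf (SN vS wS)).
Qed.

Lemma side2_clique x y : x \notin S -> comp x = comp r ->
  y \notin S -> comp y = comp r -> x != y -> adj x y.
Proof.
move=> xS cx yS cy xy; apply/negPn/negP => nxy.
case: (nonadj_cases Gcrit Gdelta xy nxy) => [d|[z H]|[z H]].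
- by have := d r'; rewrite (negPf (side2_ndom_r' xS cx)) (negPf (side2_ndom_r' yS cy)).
- by case: (side2_no_dom_but xS cx (side2_neq_r' cy) H).
- by case: (side2_no_dom_but yS cy (side2_neq_r' cx) H).
Qed.

(** An arrow inside this component would pass through [w] or [h], but [w] misses [u] and [h] misses
    [r], both in the other component. *)
Lemma side1_clique x y : x \notin S -> comp x = comp r' ->
  y \notin S -> comp y = comp r' -> x != y -> adj x y.
Proof.
move=> xS cx yS cy xy.
have [e|xr'] := eqVneq x r'.
  by rewrite e adj_sym; case: (side1_adj yS cy); rewrite // eq_sym -e.
have [e|yr'] := eqVneq y r'.
  by rewrite e; case: (side1_adj xS cx xr').
have far a v : a \notin S -> comp a = comp r' -> v \notin S -> comp v = comp r -> ~~ dom a v.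
  by move=> aS ca vS cv; apply: comp_not_dom; rewrite // ca cv eq_sym comp_rr'.
have [u [uS cu nwu]] := w_missed.
have no a b z : a \notin S -> comp a = comp r' -> b \notin S ->
    comp b = comp r' -> ~ dom_but a z b.
  move=> aS ca bS cb H; have zS := dom_but_in_cut aS H.
  have nb v : comp v = comp r -> v != b.
    by move=> cv; apply: contraNneq comp_rr' => e; rewrite -cb -e cv.
  case: (cut_pair zS) => e.
    have := dom_but_dom H (nb u cu) (far _ _ aS ca uS cu).
    by rewrite e /dom eq_sym (negPf (SN uS wS)) (negPf nwu).
  have := dom_but_dom H (nb r erefl) (far _ _ aS ca rS erefl).
  by rewrite e /dom eq_sym (negPf (SN rS hS)) (negPf (cut_nadj_r hS hw)).
apply/negPn/negP => nxy.
case: (nonadj_cases Gcrit Gdelta xy nxy) => [d|[z H]|[z H]].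
- by have := d r; rewrite (negPf (far _ _ xS cx rS _)) // (negPf (far _ _ yS cy rS _)).
- by case: (no x y z).
- by case: (no y x z).
Qed.

Lemma structure_G2_33 : in_G2_33 G.
Proof.
have [u [uS cu nwu]] := w_missed.
pose J1 := [set v | [&& v \notin S, comp v == comp r' & v != r']].
pose J2 := [set v | (v \notin S) && (comp v == comp r)].
have deg3 x : 3 <= #|[set y | adj x y]|.
  by apply: leq_trans (delta_le_degree x); apply: leq_ltn_trans Sdeg; apply: cut_gt1.
have wr' : w != r' by rewrite eq_sym SN.
have hr' : h != r' by rewrite eq_sym SN.
have J1S v : v \in J1 -> [/\ v \notin S, comp v = comp r' & v != r'].
  by rewrite inE => /and3P [? /eqP ? ?].
have J2S v : v \in J2 -> v \notin S /\ comp v = comp r.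
  by rewrite inE => /andP [? /eqP ?].
have Nr' v : adj r' v -> v \in J1.
  move=> rv; have vS : v \notin S.
    by apply: contraTN rv => vS; rewrite adj_sym cut_nadj_r'.
  by rewrite inE vS (comp_adj r'S vS rv) eqxx eq_sym adj_neq.
have cover v : [\/ v \in J1, v \in J2 | [\/ v = w, v = h | v = r']].
  have [/cut_pair [->|->]|vS] := boolP (v \in S).
  - by apply: Or33; apply: Or31.
  - by apply: Or33; apply: Or32.
  have [->|vr'] := eqVneq v r'; first by apply: Or33; apply: Or33.
  have [cv|cv] := comp_cases vS; [apply: Or32|apply: Or31];
    by rewrite inE vS cv ?vr' eqxx.
(* Here [h] plays [w_1] and misses [r] in [J2], while [w] misses [u]; [r'] plays [v_1]. *)
exists J1, J2, r, u, w, h, r'; split.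
- split.
    by apply: leq_trans (deg3 r') (subset_leq_card _); apply/subsetP => v; rewrite inE => /Nr'.
  (* [r] has degree at least 3 and [w] is its only possible neighbour in [S], so [r] and its other
     neighbours give three vertices of [J2]. *)
  have sub : r |: ([set y | adj r y] :\ w) \subset J2.
    apply/subsetP => v; rewrite !inE => /orP [/eqP->|/andP [vw rv]].
      by rewrite rS eqxx.
    have vS : v \notin S.
      by apply: contraTN rv => vS; rewrite adj_sym cut_nadj_r.
    by rewrite vS (comp_adj rS vS rv) eqxx.
  apply: leq_trans (subset_leq_card sub).
  rewrite cardsU1 !inE adj_irr andbF /= add1n ltnS -ltnS.
  apply: leq_trans (deg3 r) _; rewrite (cardsD1 w) -add1n leq_add2r.
  exact: leq_b1.
- split; rewrite ?inE ?rS ?uS ?cu ?eqxx //.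
  by apply: contraNneq nwu => <-; rewrite w_adj_r.
- split.
  + by rewrite /= !inE !negb_or (eq_sym w h) hw wr' hr'.
  + apply/pred0P => v /=; apply/negP => /andP [/J1S [_ c1 _] /J2S [_ c2]].
    by move: comp_rr'; rewrite -c1 -c2 eqxx.
  + apply/pred0P => v /=; apply/negP; rewrite !inE => /andP [/orP H].
    have [vS vr'] : v \notin S /\ v != r'.
      by case: H => [/and3P [] //|/andP [vS /eqP /side2_neq_r']].
    by case/orP => [/orP[]|] /eqP e; move: vS vr'; rewrite e ?wS ?hS ?eqxx.
- apply/setP => v; rewrite in_setT !in_setU !in_set1.
  by case: (cover v) => [->|->|[]->]; rewrite ?eqxx ?orbT.
have join_adj x y : G2_join J1 J2 r u w h r' x y -> adj x y.
  rewrite /G2_join /= => /orP [/and3P [/J1S [xS cx _] /J1S [yS cy _]]|].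
    exact: side1_clique.
  case/or4P.
  - by case/and3P => /J2S [xS cx] /J2S [yS cy]; apply: side2_clique.
  - case/andP => /eqP-> /J1S [yS cy yr']; rewrite adj_sym.
    by case: (side1_adj yS cy yr').
  - case/andP => /eqP->; rewrite !in_setU !in_set1 in_setD1 => /orP [/orP []|].
    + by case/J1S => yS cy yr'; rewrite adj_sym; case: (side1_adj yS cy yr').
    + case/andP => yr /J2S [yS cy]; apply: cut_adj_far_r' => //.
      by rewrite cy eq_sym comp_rr'.
    + by move/eqP->; rewrite adj_sym w_adj_h.
  - case/andP => /eqP->; rewrite !in_setU !in_set1 in_setD1 => /orP [/orP []|].
    + by case/J1S => yS cy yr'; apply: w_adj_far_r; rewrite // cy comp_rr'.
    + by case/andP => yr /J2S [yS cy]; apply: (w_missed_uniq uS cu nwu).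
    + by move/eqP->; apply: w_adj_h.
have sideF x y : x \in J1 -> y \in J2 -> adj x y -> False.
  move=> /J1S [xS cx _] /J2S [yS cy] /(comp_adj xS yS).
  by rewrite cx cy => e; move: comp_rr'; rewrite e eqxx.
have r'w : adj r' w = false by rewrite adj_sym (negPf (cut_nadj_r' wS)).
have r'h : adj r' h = false by rewrite adj_sym (negPf (cut_nadj_r' hS)).
have join1 x y : y \in J1 -> adj x y -> G2_join J1 J2 r u w h r' x y.
  move=> yJ xy; rewrite /G2_join /= !in_setU yJ !andbT /=.
  case: (cover x) => [xJ|xJ|[]->]; rewrite ?eqxx ?orbT //.
    by rewrite xJ adj_neq.
  by case: (sideF y x); rewrite // adj_sym.
have join2 x y : y \in J2 -> adj x y -> G2_join J1 J2 r u w h r' x y.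
  move=> yJ xy; rewrite /G2_join /= !in_setU !in_setD1 yJ !andbT /=.
  case: (cover x) => [xJ|xJ|[] e].
  - by case: (sideF x y).
  - by rewrite xJ (adj_neq xy) !orbT.
  - have yu : y != u by apply: contraNneq nwu => <-; rewrite -e.
    by rewrite e eqxx yu ?orbT.
  - have yr : y != r by apply: contraNneq (cut_nadj_r hS hw) => <-; rewrite -e.
    by rewrite e eqxx yr ?orbT.
  - rewrite e in xy; have /J1S [_ c1 _] := Nr' y xy; have [_ c2] := J2S y yJ.
    by move: comp_rr'; rewrite -c1 -c2 eqxx.
move=> x y; apply/idP/orP => [xy|[/join_adj //|/join_adj]]; last by rewrite adj_sym.
have yx : adj y x by rewrite adj_sym.
case: (cover y) => [yJ|yJ|ey]; [by left; apply: join1|by left; apply: join2|].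
case: (cover x) => [xJ|xJ|ex]; [by right; apply: join1|by right; apply: join2|].
(* Both ends are now among [w], [h], [r'], where [wh] is the only edge. *)
by case: ex xy yx => ->; case: ey => ->; rewrite ?adj_irr ?r'w ?r'h // => _ _;
  left; rewrite /G2_join /= !inE !eqxx ?orbT.
Qed.

End Structure.

End Cut.

Theorem theorem3p5 (G : sgraph) (S I : {set G})
  (Gconn : connected_graph G)
  (Gcrit : gammac_critical 3 G)
  (Smin : minimum_vertex_cut S)
  (Imax : maximum_independent I)
  (kappa_alpha : kappa G + 1 <= alpha G)
  (kappa_delta : kappa G < delta G)
  (SI : #|S :\: I| <= 1) :
  in_G2_33 G.
Proof.
have leSk := leq_kappa_cut Smin; have [Scut _] := Smin; have [Iind Icard] := Imax.
have Sdeg : #|S| < delta G := leq_ltn_trans leSk kappa_delta.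
have SltI : #|S| < #|I| by rewrite Icard; lia.
have nsub := cut_not_sub_independent Gconn Gcrit Scut Sdeg Iind SltI.
have S1 := cut_gt1 Gconn Gcrit Scut Sdeg.
have /eqP/cards1P [w eSI] : #|S :\: I| = 1.
  by apply/eqP; rewrite eqn_leq SI card_gt0 setD_eq0.
have /setDP [wS wI] : w \in S :\: I by rewrite eSI inE.
have SwI s : s \in S -> s != w -> s \in I.
  move=> sS; apply: contraNT => sI.
  have : s \in S :\: I by apply/setDP.
  by rewrite eSI inE.
have [h /andP [hS hw]] : exists h, (h \in S) && (h != w).
  case/card_gt1P: S1 => a [b [aS bS ab]].
  have [e|aw] := eqVneq a w; last by exists a; rewrite aS.
  by exists b; rewrite bS -e eq_sym.
(* [I] meets [S] in [#|S| - 1] vertices and has at least [#|S| + 1]. *)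
have : 1 < #|I :\: S|.
  have := cardsID I S; have := cardsID S I; rewrite setIC eSI cards1; lia.
case/card_gt1P => r [r' [/setDP [rI rS] /setDP [r'I r'S] rr']].
(* The middle vertex lies in [S] but not in [I], which leaves only [w]. *)
have toward a b z : a \in I -> a \notin S -> b \in I -> dom_but a z b -> dom_but a w b.
  move=> aI aS bI H; have zS := dom_but_in_cut Scut Sdeg aS H.
  suff <- : z = w by [].
  by apply/eqP; apply: contraNT (dom_but_notin Iind aI H); apply: SwI.
(* The arrow may go either way; the second case exchanges [r] and [r']. *)
case: (independent_arrow Gconn Gcrit Scut Sdeg Iind SltI rI r'I rr') => [] [z H].
  exact: (structure_G2_33 Gconn Gcrit Scut Sdeg Iind SltI wS SwI hS hw rI rS r'I r'S rr'
    (toward _ _ _ rI rS r'I H)).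
rewrite eq_sym in rr'.
exact: (structure_G2_33 Gconn Gcrit Scut Sdeg Iind SltI wS SwI hS hw r'I r'S rI rS rr'
  (toward _ _ _ r'I r'S rI H)).
Qed.
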